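(* Let $p$ be a prime, $m,n\ge 2$ integers and $a,b,c,d,e,f,g,h\in\mathbb{Z}_p$. Let $T_{\mathrm R}^{\phi_{90^\circ}}\in \mathbf{M}_{mn\times mn}(\mathbb{Z}_p)$ be the rule matrix of the finite two-dimensional linear Moore cellular automaton on an $m\times n$ grid with coefficients $a,\dots,h$ under the mixed boundary condition $\phi_{90^\circ}$ (null on the top and right, reflexive on the bottom and left). Then $T_{\mathrm R}^{\phi_{90^\circ}}$ is the $m\times m$ block matrix with $n\times n$ blocks $$T_{\mathrm R}^{\phi_{90^\circ}}=\begin{pmatrix} A_2 & F_2 & O & O &\dots & O & O & O\\ C_2 & A_2 & B_2 & O & \dots & O & O & O\\ O & C_2 & A_2 & B_2 &\dots & O & O & O\\ \vdots & \vdots & \vdots & \vdots &\ddots &\vdots & \vdots & \vdots\\ O & O & O & O & \dots & C_2 & A_2 & B_2\\ O & O & O & O & \dots & O & D_2 & A_2 \end{pmatrix},$$ where $A_2=A+h\,\epsilon_{1,2}$, $B_2=B+g\,\epsilon_{1,2}$, $C_2=C+a\,\epsilon_{1,2}$, $D_2=B+C+(a+g)\,\epsilon_{1,2}$ and $F_2=B+(a+g)\,\epsilon_{1,2}$.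
   Context: Cellular automaton. A configuration is a matrix $(x_{i,j})_{1\le i\le m,\,1\le j\le n}$ over the field $\mathbb{Z}_p$. One time step replaces every $x_{i,j}$ simultaneously by $$a x_{i-1,j-1}+b x_{i-1,j}+c x_{i-1,j+1}+d x_{i,j+1}+e x_{i+1,j+1}+f x_{i+1,j}+g x_{i+1,j-1}+h x_{i,j-1}\pmod p,$$ where values at cells outside the grid (row index $0$ or $m+1$, or column index $0$ or $n+1$) are prescribed by the boundary condition. Boundary condition $\phi_{90^\circ}$: $x_{0,l}=0$ for $1\le l\le n+1$; $x_{k,n+1}=0$ for $0\le k\le m+1$; $x_{k,0}=x_{k,2}$ for $1\le k\le m$; $x_{m+1,l}=x_{m-1,l}$ for $1\le l\le n$; $x_{0,0}=x_{2,2}$; $x_{m+1,0}=x_{m-1,2}$. Rule matrix. Identify a configuration with the column vector $X=(x_{11},\dots,x_{1n},\dots,x_{m1},\dots,x_{mn})^T\in\mathbb{Z}_p^{mn}$. The rule matrix is the matrix $T$ such that $X^{(t+1)}=T X^{(t)}$ for every configuration $X^{(t)}$ with successor $X^{(t+1)}$. Notation. All blocks are $n\times n$ over $\mathbb{Z}_p$. $P$ has ones on the first superdiagonal and zeros elsewhere; $Q=P^T$ has ones on the first subdiagonal; $I$ is the identity; $O$ is the zero matrix; $\epsilon_{k,l}$ is the matrix unit with a single $1$ in position $(k,l)$. $A=dP+hQ$, $B=fI+eP+gQ$, $C=bI+cP+aQ$. In the block matrix all diagonal blocks are $A_2$; the superdiagonal blocks are $B_2$ except the first one, in block position $(1,2)$,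 which is $F_2$; the subdiagonal blocks are $C_2$ except the last one, in block position $(m,m-1)$, which is $D_2$; all other blocks are $O$. *)

(* Defs.v *)
From HB Require Import structures.
From mathcomp Require Import all_boot all_order all_algebra.

Set Implicit Arguments.
Unset Strict Implicit.
Unset Printing Implicit Defensive.

Import GRing.Theory.
Local Open Scope ring_scope.

Section Automaton.

Variables (R : pzRingType) (m n : nat).
Implicit Type x : 'M[R]_(m, n).

(* Rows and columns are numbered from 1, so the grid is 1..m x 1..n and its
   border consists of the indices 0, m + 1 and 0, n + 1.  The value of [cell]
   matters on the grid only. *)
Definition cell x (k l : nat) : R :=
  if (insub k.-1, insub l.-1) is (Some i, Some j) then x i j else 0.

(* The configuration extended to the border: null on the top and on the right,
   reflexive on the bottom and on the left. *)
Definition phi90 x (k l : nat) : R :=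
  if (1 <= k <= m)%N && (1 <= l <= n)%N then cell x k l
  else if (k == 0)%N && (1 <= l <= n.+1)%N then 0
  else if (l == n.+1) && (k <= m.+1)%N then 0
  else if (l == 0)%N && (1 <= k <= m)%N then cell x k 2
  else if (k == m.+1) && (1 <= l <= n)%N then cell x m.-1 l
  else if (k == 0)%N && (l == 0)%N then cell x 2 2
  else if (k == m.+1) && (l == 0)%N then cell x m.-1 2
  else 0.

Definition moore_step (a b c d e f g h : R) x : 'M[R]_(m, n) :=
  let y := phi90 x in
  \matrix_(i < m, j < n)
    let k := i.+1 in let l := j.+1 in
    (a * y k.-1 l.-1 + b * y k.-1 l + c * y k.-1 l.+1 + d * y k l.+1
     + e * y k.+1 l.+1 + f * y k.+1 l + g * y k.+1 l.-1 + h * y k l.-1).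

(* [mxvec] lists the entries row by row. *)
Definition config_vec x : 'cV[R]_(m * n) := (mxvec x)^T.

Definition is_rule_matrix (a b c d e f g h : R) (T : 'M[R]_(m * n)) : Prop :=
  forall x, config_vec (moore_step a b c d e f g h x) = T *m config_vec x.

End Automaton.

Section Blocks.

Variables (R : pzRingType) (n : nat) (a b c d e f g h : R).

Definition matP : 'M[R]_n := \matrix_(i, j) (j == i.+1 :> nat)%:R.
Definition matQ : 'M[R]_n := matP^T.

(* The matrix unit in position (k, l), with k and l numbered from 1. *)
Definition eps (k l : nat) : 'M[R]_n :=
  \matrix_(i, j) ((i.+1 == k) && (j.+1 == l))%:R.

Definition matA : 'M[R]_n := d *: matP + h *: matQ.
Definition matB : 'M[R]_n := f%:M + e *: matP + g *: matQ.
Definition matC : 'M[R]_n := b%:M + c *: matP + a *: matQ.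

Definition matA2 : 'M[R]_n := matA + h *: eps 1 2.
Definition matB2 : 'M[R]_n := matB + g *: eps 1 2.
Definition matC2 : 'M[R]_n := matC + a *: eps 1 2.
Definition matD2 : 'M[R]_n := matB + matC + (a + g) *: eps 1 2.
Definition matF2 : 'M[R]_n := matB + (a + g) *: eps 1 2.

Definition block (m : nat) (i j : 'I_m) : 'M[R]_n :=
  if j == i then matA2
  else if j == i.+1 :> nat then (if i == 0 :> nat then matF2 else matB2)
  else if i == j.+1 :> nat then (if i == m.-1 :> nat then matD2 else matC2)
  else 0.

End Blocks.

Lemma sum_ord_const (m n : nat) : (\sum_(i < m) n = m * n)%N.
Proof. by rewrite sum_nat_const card_ord. Qed.

Definition block_matrix (R : pzRingType) (m n : nat) (a b c d e f g h : R) :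
    'M[R]_(m * n) :=
  castmx (sum_ord_const m n, sum_ord_const m n)
    (\mxblock_(i < m, j < m) block n a b c d e f g h i j).

(* Main.v *)
Require Import Defs.
From HB Require Import structures.
From mathcomp Require Import all_boot all_order all_algebra.
From mathcomp Require Import zify ring.

Set Implicit Arguments.
Unset Strict Implicit.
Unset Printing Implicit Defensive.

Import GRing.Theory.
Local Open Scope ring_scope.

(** The boundary condition only copies or kills grid cells, so every extended
value [phi90 x k l] is a linear form in the entries of [x] with coefficients 0
and 1: the cell [(k, l)] sees the grid cell [(i, j)] or it does not
([phi90E]).  One time step is therefore linear, and the coefficient of
[x i' j'] in the new value at [(i, j)] is a combination of eight such 0/1
numbers with weights [a], ..., [h].

These numbers nearly factor as a row part times a column part.  The column part
for the neighbours to the right, in the same column and to the left is the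
[(j, j')] entry of [P], [I] and [Q + eps 1 2] respectively, the extra unit being
the reflection of column 0 onto column 2.  The row part says that [i'] is the
row above, the same row or the row below [i]; for the last row the reflection at
the bottom border adds the contributions from below to those from above, which
is how [B] enters [D_2].  The only failure of factorization is
the corner [(0, 0)], which copies [(2, 2)] although the top row is null: it adds
[a * eps 1 2] to the block [(1, 2)], which turns [B_2] into [F_2].  Summing up
gives exactly the entries of the blocks ([stencil_block]).

It follows that the block matrix is a rule matrix ([block_matrix_step]).  It is
the only one because every column vector is the vector of some configuration
([eq_mul_config_vec]).  The two enumerations of the cells involved, the one of
[mxvec] and the one of [\mxblock], agree ([mxvec_index_Rank]). *)

Lemma index_allpairs (S T : eqType) (s : seq S) (t : seq T) i j :
  i \in s -> j \in t ->
  index (i, j) [seq (x, y) | x <- s, y <- t]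
    = (index i s * size t + index j t)%N.
Proof.
move=> + jt; elim: s => // x s IHs.
rewrite inE allpairs_cons index_cat /= [x == i]eq_sym.
have [->|ix] /= := eqVneq i x.
  by move=> _; rewrite map_f // index_map // => y z [].
move=> /IHs ->; rewrite size_map mulSn addnA ifF //.
by apply/negP => /mapP[y _ [eix _]]; rewrite eix eqxx in ix.
Qed.

(** Both indices are the row-major position [i * n + j]. *)
Lemma mxvec_index_Rank m n (i : 'I_m) (j : 'I_n) :
  mxvec_index i j = cast_ord (sum_ord_const m n) (@tagnat.Rank m (fun=> n) i j).
Proof.
apply: val_inj; rewrite [RHS](@tagnat.RankEsum m (fun=> n)) /=.
rewrite /enum_rank enum_rank_in.unlock insubdK; last first.
  by rewrite -[_ \in _]/(index _ _ < _)%N cardE index_mem mem_enum.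
rewrite enumT unlock /= /prod_enum index_allpairs ?mem_enum //.
rewrite !index_enum_ord size_enum_ord; congr (_ + _)%N.
by rewrite -(big_ord_widen m (fun=> n) (ltnW (ltn_ord i))) sum_ord_const.
Qed.

Lemma block_matrixE (R : pzRingType) m n (a b c d e f g h : R)
    (i i' : 'I_m) (j j' : 'I_n) :
  block_matrix m n a b c d e f g h (mxvec_index i j) (mxvec_index i' j')
    = block n a b c d e f g h i i' j j'.
Proof.
rewrite /block_matrix !mxvec_index_Rank castmxE !cast_ordK.
have /matrixP/(_ j j') :=
  @mxblockK R m m (fun=> n) (fun=> n) (@block R n a b c d e f g h m) i i'.
by rewrite mxE.
Qed.

Lemma mulmx_config_vec (R : comPzRingType) m n (T : 'M[R]_(m * n))
    (x : 'M[R]_(m, n)) s :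
  (T *m config_vec x) s 0 = \sum_i \sum_j T s (mxvec_index i j) * x i j.
Proof.
rewrite mxE (reindex (uncurry (@mxvec_index m n))) /=; last first.
  exact: curry_mxvec_bij.
rewrite pair_bigA; apply: eq_bigr => -[i j] _ /=.
by rewrite /config_vec mxE mxvecE.
Qed.

(** Since [vec_mx] is onto, configurations supply all the basis vectors, and
hence all the columns of [T] and [U]. *)
Lemma eq_mul_config_vec (R : nzRingType) m n (T U : 'M[R]_(m * n)) :
  (forall x : 'M[R]_(m, n), T *m config_vec x = U *m config_vec x) -> T = U.
Proof.
move=> eqTU; apply/trmx_inj/row_matrixP => k.
have := eqTU (vec_mx (delta_mx 0 k)).
rewrite /config_vec vec_mxK trmx_delta -!colE => /(congr1 trmx).
by rewrite !tr_col.
Qed.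

(** Whether the extended cell [(k, l)], in coordinates starting from 1, copies
the grid entry [(i, j)], in coordinates starting from 0.  The first two
disjuncts for the row are the cell itself and the mirror image of the bottom
border; the last one is the corner [(0, 0)]. *)
Definition reads (m k l i j : nat) : bool :=
  [|| k == i.+1, (k == m.+1) && (i.+2 == m) | [&& k == 0, l == 0 & i == 1]]%N
  && ((l == j.+1) || (l == 0) && (j == 1))%N.

(** Outside the grid no [(i, j)] is selected, in accordance with the default
value 0 of [cell]. *)
Lemma cellE (R : pzRingType) m n (x : 'M[R]_(m, n)) k l :
  cell x k.+1 l.+1 =
    \sum_(i < m) \sum_(j < n) ((k == i) && (l == j))%:R * x i j.
Proof.
rewrite pair_bigA /cell /=.
case: insubP => [i lt_km <-|]; last first.
  rewrite -leqNgt => le_mk; rewrite big1 // => -[i j] _ /=.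
  by rewrite gtn_eqF ?mul0r // (leq_trans (ltn_ord i)).
case: insubP => [j lt_ln <-|]; last first.
  rewrite -leqNgt => le_nl; rewrite big1 // => -[i' j] _ /=.
  by rewrite andbC gtn_eqF ?mul0r // (leq_trans (ltn_ord j)).
rewrite (bigD1 (i, j)) //= !eqxx mul1r big1 ?addr0 // => -[i' j'] /=.
rewrite xpair_eqE negb_and => neq; rewrite -!val_eqE in neq.
by case/orP: neq => /negPf; rewrite eq_sym => ->; rewrite ?andbF mul0r.
Qed.

(** In each region of the extended grid either one grid entry is copied or none
is, so [reads] selects that entry or nothing.  The bound [2 <= m] makes sure
that the mirror row [m - 1] belongs to the grid. *)
Lemma phi90E (R : pzRingType) m n (x : 'M[R]_(m, n)) k l :
  (2 <= m)%N -> (k <= m.+1)%N -> (l <= n.+1)%N ->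
  phi90 x k l = \sum_(i < m) \sum_(j < n) (reads m k l i j)%:R * x i j.
Proof.
move=> m2 km ln.
have read_cell k' l' : (0 < k')%N -> (0 < l')%N ->
    (forall (i : 'I_m) (j : 'I_n),
       reads m k l i j = (k' == i.+1) && (l' == j.+1)) ->
    cell x k' l' = \sum_(i < m) \sum_(j < n) (reads m k l i j)%:R * x i j.
  case: k' l' => [|k'] [|l'] // _ _ eq_reads; rewrite cellE.
  by apply: eq_bigr => i _; apply: eq_bigr => j _; rewrite eq_reads !eqSS.
have read_null : (forall (i : 'I_m) (j : 'I_n), reads m k l i j = false) ->
    0 = \sum_(i < m) \sum_(j < n) (reads m k l i j)%:R * x i j.
  move=> eq_reads; rewrite big1 // => i _; rewrite big1 // => j _.
  by rewrite eq_reads mul0r.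
rewrite /phi90.
repeat case: ifP => ?.
all: first [apply: read_cell => [||i j] | apply: read_null => i j]; try lia.
all: have := ltn_ord i; have := ltn_ord j; rewrite /reads; lia.
Qed.

(** The contributions of [x i' j'] to the new value at [(i, j)] add up to an
entry of a block because [reads] splits into a row part and a column part, up to
the corner term. *)
Lemma stencil_block (R : comPzRingType) m n (a b c d e f g h : R)
    (i i' : 'I_m) (j j' : 'I_n) :
  (2 <= m)%N ->
  let y k l : R := (reads m k l i' j')%:R in
  let k := i.+1 in let l := j.+1 in
  a * y k.-1 l.-1 + b * y k.-1 l + c * y k.-1 l.+1 + d * y k l.+1
    + e * y k.+1 l.+1 + f * y k.+1 l + g * y k.+1 l.-1 + h * y k l.-1
  = block n a b c d e f g h i i' j j'.
Proof.
move=> m2 /=; have lt_im := ltn_ord i; have lt_i'm := ltn_ord i'.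
(* The row part of [reads], without the corner [(0, 0)]. *)
pose row k : bool := ((k == i'.+1) || (k == m.+1) && (i'.+2 == m))%N.
have natr_or (s t : bool) : ~~ (s && t) -> (s || t)%:R = s%:R + t%:R :> R.
  by case: s t => [] [] // _; rewrite ?addr0 ?add0r.
(* The column left of [j] is a grid column, or column 0 reflected to column 2. *)
have left_col : ((j == j'.+1 :> nat) || (j == 0 :> nat) && (j' == 1 :> nat))%:R
    = matQ R n j j' + eps R n 1 2 j j'.
  by rewrite natr_or ?(mxE, eqSS) //; lia.
have readP k : (reads m k j.+2 i' j')%:R = (row k)%:R * matP R n j j'.
  by rewrite mxE -natrM mulnb; congr (nat_of_bool _)%:R; rewrite /reads /row; lia.
have readI k : (reads m k j.+1 i' j')%:R = (row k)%:R * (1%:M : 'M[R]_n) j j'.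
  rewrite mxE -natrM mulnb -val_eqE /=.
  by congr (nat_of_bool _)%:R; rewrite /reads /row; lia.
(* For [k = 0] the corner interferes, so the upper left neighbour is apart. *)
have readQ k : (0 < k)%N -> (reads m k j i' j')%:R
    = (row k)%:R * (matQ R n j j' + eps R n 1 2 j j').
  move=> k_gt0; rewrite -left_col -natrM mulnb.
  by congr (nat_of_bool _)%:R; rewrite /reads /row; lia.
have readC : (reads m i j i' j')%:R
    = (row i)%:R * (matQ R n j j' + eps R n 1 2 j j')
      + ((i == 0 :> nat) && (i' == 1 :> nat))%:R * eps R n 1 2 j j'.
  rewrite -left_col [eps _ _ _ _ _ _]mxE -!natrM !mulnb -natr_or.
    by congr (nat_of_bool _)%:R; rewrite /reads /row; lia.
  by rewrite /row; lia.
rewrite readC !readP !readI !readQ //.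
have -> : row i = (i == i'.+1 :> nat) by rewrite /row; lia.
have -> : row i.+1 = (i' == i) by rewrite -val_eqE /row /=; lia.
(* In the last row, the row below is the reflected row above. *)
have -> : row i.+2 = ((i' == i.+1 :> nat)
    || (i == m.-1 :> nat) && (i == i'.+1 :> nat)) by rewrite /row; lia.
rewrite /block -val_eqE /=.
have entry0 : (0 : 'M[R]_n) j j' = 0 by rewrite mxE.
have entryE (M : 'M[R]_n) s :
    (M + s *: eps R n 1 2) j j' = M j j' + s * eps R n 1 2 j j'.
  by rewrite !mxE.
have entryA : matA n d h j j' = d * matP R n j j' + h * matQ R n j j'.
  by rewrite /matA !mxE.
have entryB : matB n e f g j j'
    = f * (1%:M : 'M[R]_n) j j' + e * matP R n j j' + g * matQ R n j j'.
  by rewrite /matB -[f%:M]scalemx1 !mxE.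
have entryC : matC n a b c j j'
    = b * (1%:M : 'M[R]_n) j j' + c * matP R n j j' + a * matQ R n j j'.
  by rewrite /matC -[b%:M]scalemx1 !mxE.
have entryBC : (matB n e f g + matC n a b c) j j'
    = matB n e f g j j' + matC n a b c j j' by exact: mxE.
rewrite /matA2 /matF2 /matB2 /matC2 /matD2.
(* What is left depends on the relative position of the two rows, and on whether
   [i] is the first or the last row. *)
repeat case: eqP => ? /=; try (exfalso; lia).
all: rewrite ?entry0 // ?entryE ?entryBC ?entryA ?entryB ?entryC; ring.
Qed.

Lemma block_matrix_step (R : comPzRingType) m n (a b c d e f g h : R)
    (x : 'M[R]_(m, n)) :
  (2 <= m)%N ->
  config_vec (moore_step a b c d e f g h x)
    = block_matrix m n a b c d e f g h *m config_vec x.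
Proof.
move=> m2; apply/colP; case/mxvec_indexP => i j.
rewrite mulmx_config_vec /config_vec mxE mxvecE mxE /=.
have lt_im := ltn_ord i; have lt_jn := ltn_ord j.
rewrite !phi90E; try lia.
rewrite !big_distrr -!big_split /=; apply: eq_bigr => i' _.
rewrite !big_distrr -!big_split /=; apply: eq_bigr => j' _.
rewrite block_matrixE -stencil_block //=.
by ring.
Qed.

Theorem theorem3p3 (p : nat) (hp : prime p) (m n : nat)
    (hm : (2 <= m)%N) (hn : (2 <= n)%N) (a b c d e f g h : 'F_p)
    (T : 'M['F_p]_(m * n)) :
  is_rule_matrix a b c d e f g h T <-> T = block_matrix m n a b c d e f g h.
Proof.
split=> [rule_T | -> x]; last exact: block_matrix_step.
apply: (@eq_mul_config_vec _ m n) => x.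
by rewrite -rule_T block_matrix_step.
Qed.
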